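(* Let $\mathcal{P}=\sum_{j=0}^n\mathcal{P}_j\mathsf{Y}^j\in\mathcal{C}[\mathsf{Y}]$. Assume that there exist $p=\sum_{j=0}^n p_j\mathsf{Y}^j\in\mathbb{C}[\mathsf{Y}]$ and $P=\bigoplus_{j=0}^nP_j\mathsf{Y}^j\in\mathbb{R}_{\min}[\mathsf{Y}]$ satisfying $\mathcal{P}_j(\epsilon)\simeq p_j\epsilon^{P_j}$ for $j=0,\dots,n$. Let $c\in\mathbb{R}$ be a finite root of $P$ with multiplicity $m$, and assume that the polynomial $$p^{(c)}=\sum_{0\le j\le n,\ \widehat P(c)=P_j+jc}p_j\mathsf{Y}^j\in\mathbb{C}[\mathsf{Y}]$$ is not identically zero. Let $y_1,\dots,y_\ell$ denote its non-zero roots (counted with multiplicities). Then $\ell\le m$, and there exist $\ell$ roots of $\mathcal{P}$ (counted with multiplicities), $\mathcal{Y}_1,\dots,\mathcal{Y}_\ell\in\mathcal{C}$, having first order asymptotics of the form $\mathcal{Y}_i\sim y_i\epsilon^c$. Moreover, if $v=\operatorname{val}p^{(c)}>0$, then $v\ge m'$, where $m'$ is the sum of the multiplicities of all the roots of $P$ greater than $c$ ($+\infty$ included), and there exist $v$ roots of $\mathcal{P}$ (counted with multiplicities) $\mathcal{Y}_{1+\ell},\dots,\mathcal{Y}_{v+\ell}\in\mathcal{C}$ such that $\mathcal{Y}_i\simeq 0\,\epsilon^c$ for $1\le i-\ell\le v$. Finally, the remaining $n-v-\ell$ roots $\mathcal{Y}$ of $\mathcal{P}$ are such that $\mathcal{Y}\epsilon^{-c}$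 tends to infinity when $\epsilon$ goes to $0$, and their number satisfies $n-v-\ell\ge n-m-m'$.
   Context: $\mathcal{C}$ is the ring of germs at $0^+$ of continuous functions $f:(0,\epsilon_0)\to\mathbb{C}$ (some $\epsilon_0>0$) such that $|f(\epsilon)|\le\epsilon^{-k}$ on $(0,\epsilon_0)$ for some constant $k>0$ (functions coinciding near $0$ are identified). For $f\in\mathcal{C}$, $a\in\mathbb{C}$, $A\in\mathbb{R}\cup\{+\infty\}$: $f(\epsilon)\simeq a\epsilon^A$ means $\lim_{\epsilon\to0^+}\epsilon^{-A}f(\epsilon)=a$ if $A\in\mathbb{R}$, and $f=0$ (near $0$) if $A=+\infty$. One writes $f\sim a\epsilon^A$, and says $f$ has first order asymptotics, if $f\simeq a\epsilon^A$ and either $A\in\mathbb{R}$, $a\ne0$, or $A=+\infty$. $\mathbb{R}_{\min}=\mathbb{R}\cup\{+\infty\}$ is the min-plus semifield (addition $\min$, multiplication $+$). For a formal polynomial $P=\bigoplus_jP_j\mathsf{Y}^j$ over $\mathbb{R}_{\min}$ (not identically $+\infty$), $\widehat P(y)=\min_j(P_j+jy)$ is the associated polynomial function (the term $j=0$ being $P_0$); if $N=\max\{j: P_j\neq+\infty\}$, then $\widehat P$ factors uniquely as $\widehat P(y)=P_N+\sum_{i=1}^N\min(y,c_i)$ with $c_1\le\cdots\le c_N$ in $\mathbb{R}_{\min}$. The $c_i$ are the roots of $P$, and the multiplicity of a root is the number of times it occurs among the $c_i$. $\operatorname{val}q$ is the smallest $k$ such that the coefficient of $\mathsf{Y}^k$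 in $q$ is non-zero. A root of $\mathcal{P}$ is a root of $\mathcal{P}(\epsilon)=\sum_j\mathcal{P}_j(\epsilon)\mathsf{Y}^j$ depending on small $\epsilon>0$. The $n$ roots of $\mathcal{P}(\epsilon)$ are counted with multiplicities in $\mathbb{C}\cup\{\infty\}$, with $\infty$ a root of multiplicity $n-\deg\mathcal{P}(\epsilon)$ when $\deg\mathcal{P}(\epsilon)<n$. ''The remaining roots $\mathcal{Y}$ are such that $\mathcal{Y}\epsilon^{-c}$ tends to infinity'' means: for every $R>0$, for all small enough $\epsilon>0$, all the roots of $\mathcal{P}(\epsilon)$ other than $\mathcal{Y}_1(\epsilon),\dots,\mathcal{Y}_{v+\ell}(\epsilon)$ have modulus larger than $R\epsilon^c$ ($\infty$ satisfying this). *)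

(* Defs.v *)
From HB Require Import structures.
From mathcomp Require Import all_boot all_order all_algebra.
From mathcomp Require Import all_classical all_reals all_analysis.
From mathcomp Require Import complex.

Set Implicit Arguments.
Unset Strict Implicit.
Unset Printing Implicit Defensive.

Import Order.TTheory GRing.Theory Num.Theory numFieldNormedType.Exports.

Local Open Scope classical_set_scope.
Local Open Scope ring_scope.
Local Open Scope complex_scope.

(* The topology on [R[i]] given by its modulus. *)
HB.instance Definition _ (R : realType) := NormedModule.copy R[i] R[i]^o.

(* The min-plus semifield: the semiring operations [+], [*], [0], [1] on
   [Rmin R] are min, +, +oo and 0.  Hence [x ^+ j] is [j] times [x] (with
   [x ^+ 0 = 1], the real number 0, even for [x = +oo]), [{poly Rmin R}] is the
   semiring of formal min-plus polynomials, [size P] is one more than the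
   largest [j] with [P`_j] finite, and [P.[y]] is the value at [y] of the
   associated polynomial function. *)
Record Rmin (R : realType) : Type :=
  MkRmin { rmin_val : \bar R; rmin_valP : rmin_val != -oo%E }.

HB.instance Definition _ (R : realType) := [isSub for @rmin_val R].
HB.instance Definition _ (R : realType) := [Choice of Rmin R by <:].

Section MinPlus.
Variable R : realType.
Implicit Types x y z : Rmin R.

Definition rmin_fin (r : R) : Rmin R := @MkRmin R r%:E isT.
Definition rmin_oo : Rmin R := @MkRmin R +oo%E isT.

Fact rmin_add_subproof x y :
  Order.min (rmin_val x) (rmin_val y) != -oo%E.
Proof. by rewrite minEle; case: ifP => _; apply: rmin_valP. Qed.

Definition rmin_add x y : Rmin R := MkRmin (rmin_add_subproof x y).

Fact rmin_mul_subproof x y : (rmin_val x + rmin_val y)%E != -oo%E.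
Proof. by case: x y => [[r| |] Hx] [[s| |] Hy]. Qed.

Definition rmin_mul x y : Rmin R := MkRmin (rmin_mul_subproof x y).

Fact rmin_addA : associative rmin_add.
Proof. by move=> x y z; apply/val_inj; rewrite /= minA. Qed.

Fact rmin_addC : commutative rmin_add.
Proof. by move=> x y; apply/val_inj; rewrite /= minC. Qed.

Fact rmin_add0 : left_id rmin_oo rmin_add.
Proof. by move=> x; apply/val_inj; rewrite /= min_r ?leey. Qed.

Fact rmin_mulA : associative rmin_mul.
Proof. by move=> x y z; apply/val_inj; rewrite /= addeA. Qed.

Fact rmin_mulC : commutative rmin_mul.
Proof. by move=> x y; apply/val_inj; rewrite /= addeC. Qed.

Fact rmin_mul1 : left_id (rmin_fin 0) rmin_mul.
Proof. by move=> x; apply/val_inj; rewrite /= add0e. Qed.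

Fact rmin_mulD : left_distributive rmin_mul rmin_add.
Proof.
move=> x y z; apply/val_inj => /=; rewrite !minEle.
case: (leP (rmin_val x) (rmin_val y)) => h; case: ifPn => // h'.
  by rewrite leeD2r in h'.
by apply/eqP; rewrite eq_le h' leeD2r // ltW.
Qed.

Fact rmin_mul0 : left_zero rmin_oo rmin_mul.
Proof. by case=> x Hx; apply/val_inj; rewrite /= addye. Qed.

Fact rmin_one_neq0 : rmin_fin 0 != rmin_oo.
Proof. by []. Qed.

HB.instance Definition _ :=
  GRing.isNmodule.Build (Rmin R) rmin_addA rmin_addC rmin_add0.

HB.instance Definition _ :=
  GRing.Nmodule_isComNzSemiRing.Build (Rmin R)
    rmin_mulA rmin_mulC rmin_mul1 rmin_mulD rmin_mul0 rmin_one_neq0.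

(* [cs] lists the roots c_1 <= ... <= c_N of [P], i.e.
   P(y) = P_N + \sum_i min(y, c_i) for all y in the min-plus semifield;
   the sum and minima are written in semiring notation. *)
Definition minplus_roots (P : {poly Rmin R}) (cs : seq (Rmin R)) : Prop :=
  [/\ P != 0,
      size cs = (size P).-1,
      sorted (fun c d => (rmin_val c <= rmin_val d)%E) cs
    & forall y : Rmin R, P.[y] = lead_coef P * \prod_(c <- cs) (y + c)].

End MinPlus.

Section Germs.
Variable R : realType.
Implicit Types (f : R -> R[i]) (a : R[i]) (A : Rmin R).

(* Germs at 0+ are represented by functions on the whole of [R]; only the values
   at small positive arguments matter in what follows. *)
Definition in_germs f : Prop :=
  exists e0 : R, [/\ 0 < e0,
    {in `]0, e0[, continuous f}
  & exists2 k : R, 0 < k &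
      forall e : R, 0 < e < e0 -> `|f e| <= (e `^ (- k))%:C].

Definition simeq_asym f a A : Prop :=
  if rmin_val A is r%:E
  then (e `^ (- r))%:C * f e @[e --> 0^'+] --> a
  else \forall e \near 0^'+, f e = 0.

Definition sim_asym f a A : Prop :=
  simeq_asym f a A /\
  ((rmin_val A \is a fin_num /\ a != 0) \/ rmin_val A = +oo%E).

End Germs.

Section Roots.
Variable R : realType.
Implicit Types (q : {poly R[i]}) (n : nat).

(* The finite roots of [q != 0], listed with multiplicities. *)
Definition croots q : seq R[i] := sval (closed_field_poly_normal q).

(* The [n] roots in the projective line of [q != 0] of formal degree [n];
   [None] is the point at infinity. *)
Definition proj_roots n q : seq (option R[i]) :=
  map Some (croots q) ++ nseq (n - (size q).-1) None.

Definition poly_val q : nat := find (fun a => a != 0) q.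

(* The polynomial p^(c). *)
Definition saturated_poly n (p : {poly R[i]}) (P : {poly Rmin R}) (c : Rmin R) :
    {poly R[i]} :=
  \poly_(j < n.+1) (if P.[c] == P`_j * c ^+ j then p`_j else 0).

Definition poly_at n (PP : nat -> R -> R[i]) (e : R) : {poly R[i]} :=
  \poly_(j < n.+1) PP j e.

(* [|z| > r], the point at infinity satisfying this for all [r]. *)
Definition modulus_gt (z : option R[i]) (r : R) : Prop :=
  if z is Some w then r%:C < `|w| else True.

End Roots.

(* Main.v *)
Require Import Defs.
From HB Require Import structures.
From mathcomp Require Import all_boot all_order all_algebra.
From mathcomp Require Import all_classical all_reals all_analysis.
From mathcomp Require Import complex.
From mathcomp Require Import lra zify.

(* Substituting Y = e^c X and dividing by e^(Phat(c)) turns P(e) into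
   a polynomial A(e) whose coefficients extend continuously to e = 0, where A(0)
   is p^(c).  A continuous family of formal degree n with deg A(0) > 0 has a
   continuous root near e = 0: for a fine grid in e, follow the bounded roots
   greedily from one grid point to the next, and take a limit along an
   ultrafilter of grids; the discontinuities stay small because a chain of small
   jumps inside a neighbourhood of at most n points cannot travel far.  Dividing
   by X - (this root) keeps the coefficients continuous, so d = deg p^(c)
   repetitions give d continuous roots, with values at 0 the roots of p^(c), and
   a cofactor which is a non-zero constant at e = 0; the roots of the cofactor
   therefore tend to infinity.  The inequalities on multiplicities express that
   the terms j of P which are minimal at c lie between m' and m' + m, the slopes
   of the concave function Phat on both sides of c. *)

Set Implicit Arguments.
Unset Strict Implicit.
Unset Printing Implicit Defensive.

Import Order.TTheory GRing.Theory Num.Theory numFieldNormedType.Exports.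

Local Open Scope classical_set_scope.
Local Open Scope ring_scope.

(** * Continuous selections *)

(** Induction on the number of centres in [W]. If [w] is near [x 0] and [M] is the last index near
    [w], reaching [x M] costs at most [2 eta], one more jump leads to [x M.+1], and from there on
    [w] can be discarded. Each centre costs [3 eta], whatever the length of the chain. *)
Lemma chain_dist (R : realDomainType) (T : eqType) (d : T -> T -> R)
    (d_sym : forall x y, d x y = d y x)
    (d_tri : forall x y z, d x z <= d x y + d y z)
    (eta : R) (W : seq T) (x : nat -> T) (n : nat) :
  0 <= eta ->
  (forall i, (i <= n)%N -> exists2 w, w \in W & d (x i) w <= eta) ->
  (forall i, (i < n)%N -> d (x i) (x i.+1) <= eta) ->
  d (x 0%N) (x n) <= eta *+ (3 * size W).
Proof.
move=> eta0; move: {-1}(size W) (leqnn (size W)) => N.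
elim: N W x n => [|N IH] W x n sW nearW jump.
  by have [w] := nearW 0%N isT; move: sW; rewrite leqn0 size_eq0 => /eqP->.
have [w wW x0w] := nearW 0%N isT.
pose near_w i := (i <= n)%N && (d (x i) w <= eta).
have exw : exists i, near_w i by exists 0%N; apply/andP.
have bdw i : near_w i -> (i <= n)%N by case/andP.
case: (ex_maxnP exw bdw) => M /andP[Mn xMw] Mmax.
have x0M : d (x 0%N) (x M) <= eta *+ 2.
  by rewrite (le_trans (d_tri _ w _))// mulr2n lerD// d_sym.
rewrite mulnSr addnC mulrnDr.
have [->|MnE] := eqVneq n M.
  rewrite (le_trans x0M)// (le_trans (ler_wpMn2l eta0 (leqnSn 2)))//.
  by rewrite lerDl mulrn_wge0.
have {MnE}Mn : (M < n)%N by rewrite ltn_neqAle eq_sym MnE.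
pose W' := [seq w' <- W | w' != w].
have sW' : (size W' <= N)%N.
  rewrite -ltnS; apply: leq_trans sW.
  by rewrite size_filter -(count_predC (pred1 w) W) -[ltnLHS]add0n ltn_add2r
    -has_count has_pred1.
have := IH W' (fun i => x (M.+1 + i)%N) (n - M.+1)%N sW'.
rewrite addn0 subnKC// => IH'.
have {IH'} : d (x M.+1) (x n) <= eta *+ (3 * N).
  apply: (IH') => [i iM|i iM]; last by rewrite addnS; apply: jump; lia.
  have Min : (M.+1 + i <= n)%N by lia.
  have [w' w'W xw'] := nearW _ Min; exists w' => //.
  rewrite mem_filter w'W andbT; apply/eqP => ww'.
  have := Mmax (M.+1 + i)%N; rewrite /near_w Min -ww' xw' => /(_ isT); lia.
move=> xMn; rewrite (le_trans (d_tri _ (x M) _))// mulrS [eta + _]addrC -addrA.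
rewrite lerD// (le_trans (d_tri _ (x M.+1) _))// lerD// jump//.
Qed.

(** The fibres of [f] split the indices into finitely many classes, and an ultrafilter contains one
    of them. *)
Lemma ultra_const (U : set_system nat) (T : eqType) (W : seq T)
    (f : nat -> T) : UltraFilter U -> (forall k, f k \in W) ->
  exists2 w, w \in W & U [set k | f k = w].
Proof.
move=> UU fW; have : U [set k | f k \in W].
  by apply: filterS filterT => k _; exact: fW.
elim: W {fW} => [|w W IH] Uf.
  by have [k] := filter_ex Uf.
have [Uw|Uw] := in_ultra_setVsetC [set k | f k = w] UU.
  by exists w; rewrite ?mem_head.
have [|w' w'W Uw'] := IH.
  apply: filterS (filterI Uf Uw) => k [/=]; rewrite inE => /orP[/eqP//|//].
by exists w'; rewrite // inE w'W orbT.
Qed.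

(* [f t] is close to the point reached at the last grid time before [t]; the
   grid has mesh [dl / 2]. *)
Lemma grid_selection (R : realType) (T : eqType) (d : T -> T -> R)
    (d_sym : forall x y, d x y = d y x)
    (d_tri : forall x y z, d x z <= d x y + d y z)
    (b : R) (N : nat) (Z : R -> seq T) (dl eta : R) :
  0 <= b -> (forall t, 0 <= t <= b -> (size (Z t) <= N)%N) ->
  (exists z, z \in Z 0) -> 0 < dl -> 0 < eta ->
  (forall s t, 0 <= s <= b -> 0 <= t <= b -> `|s - t| < dl ->
    forall z, z \in Z t -> exists2 w, w \in Z s & d z w <= eta) ->
  exists f : R -> T, (forall t, 0 <= t <= b -> f t \in Z t) /\
  forall dl' eta', dl <= dl' -> eta <= eta' ->
   (forall s t, 0 <= s <= b -> 0 <= t <= b -> `|s - t| < dl' ->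
    forall z, z \in Z t -> exists2 w, w \in Z s & d z w <= eta') ->
   forall s t, 0 <= s <= b -> 0 <= t <= b -> `|s - t| < dl' / 2 ->
    d (f s) (f t) <= eta' *+ (3 * N + 2).
Proof.
move=> b0 sZ [z0 z0Z] dl0 eta0 closeZ.
(* The greedy move to time [u], falling back on [z] if no point of [Z u] is close enough. *)
pose g u z := nth z (Z u) (find (fun w => d z w <= eta) (Z u)).
have gP s t z : 0 <= s <= b -> 0 <= t <= b -> `|s - t| < dl -> z \in Z t ->
    g s z \in Z s /\ d z (g s z) <= eta.
  move=> sb tb st zt; have [w wZ zw] := closeZ _ _ sb tb st _ zt.
  have hs : has (fun w => d z w <= eta) (Z s) by apply/hasP; exists w.
  by split; [rewrite mem_nth -?has_find|exact: (nth_find z hs)].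
pose h := dl / 2.
have h0 : 0 < h by rewrite divr_gt0.
pose x := fix x i := if i is j.+1 then g (i%:R * h) (x j) else z0.
have ih0 i : 0 <= i%:R * h :> R by rewrite mulr_ge0// ltW.
have xS i : i.+1%:R * h <= b -> x i \in Z (i%:R * h) ->
    x i.+1 \in Z (i.+1%:R * h) /\ d (x i) (x i.+1) <= eta.
  move=> ib xi; apply: (gP _ (i%:R * h)) => //; rewrite ?ih0//=.
    by apply: le_trans ib; rewrite ler_pM2r// ler_nat.
  by rewrite -mulrBl -natrB// subSnn mul1r gtr0_norm// /h; lra.
have xZ i : i%:R * h <= b -> x i \in Z (i%:R * h).
  elim: i => [|i IH] ib; first by rewrite mul0r.
  apply: (xS i ib _).1; apply: IH; apply: le_trans ib.
  by rewrite ler_pM2r// ler_nat.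
pose k t := Num.truncn (t / h).
have kP t : 0 <= t -> (k t)%:R * h <= t < (k t)%:R * h + h.
  move=> t0; have /truncn_itv := divr_ge0 t0 (ltW h0).
  rewrite -/(k t) -addn1 natrD => /andP[].
  by rewrite ler_pdivlMr// ltr_pdivrMr// mulrDl mul1r => -> ->.
have fP t : 0 <= t <= b -> g t (x (k t)) \in Z t /\
    d (x (k t)) (g t (x (k t))) <= eta.
  move=> /andP[t0 tb]; have /andP[k1 k2] := kP t t0.
  have kb := le_trans k1 tb.
  apply: (gP _ ((k t)%:R * h)); rewrite ?t0 ?ih0 ?xZ//.
  by rewrite ger0_norm ?subr_ge0// ltrBlDl (lt_le_trans k2)// lerD2l /h; lra.
(* This selection depends on [dl] and [eta] alone, so one function obeys the estimate at all coarser
   scales [dl'], [eta']. *)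
exists (fun t => g t (x (k t))); split => [t /fP[]//|].
move=> dl' eta' dldl' etaeta' closeZ'.
suff le_st s t : s <= t -> 0 <= s <= b -> 0 <= t <= b -> `|s - t| < dl' / 2 ->
    d (g s (x (k s))) (g t (x (k t))) <= eta' *+ (3 * N + 2).
  move=> s t sb tb st; have [/le_st->//|/ltW ts] := leP s t.
  by rewrite d_sym; apply: le_st => //; rewrite distrC.
move=> st sb tb; rewrite distrC ger0_norm ?subr_ge0// => dst.
have [_ fs] := fP s sb; have [_ ft] := fP t tb.
have /andP[s0 sb'] := sb; have /andP[t0 tb'] := tb.
have /andP[ks1 ks2] := kP s s0; have /andP[kt1 kt2] := kP t t0.
have kst : (k s <= k t)%N by apply: le_truncn; rewrite ler_pM2r ?invr_gt0.
(* The grid times involved stay within [dl'] of [s]: the last is at most [t < s + dl' / 2], and the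
   first precedes [s] by less than the mesh [dl / 2]. *)
have idl i : (i <= k t - k s)%N -> 0 <= (k s + i)%:R * h <= b /\
    `|s - (k s + i)%:R * h| < dl'.
  move=> ile; have kt : (k s + i)%:R * h <= (k t)%:R * h.
    by rewrite ler_pM2r// ler_nat -leq_subRL.
  have ks : (k s)%:R * h <= (k s + i)%:R * h.
    by rewrite ler_pM2r// ler_nat leq_addr.
  split; first by rewrite ih0/= (le_trans kt)// (le_trans kt1).
  rewrite ltr_norml; apply/andP; split.
    by move: dst kt1 kt; rewrite /h; lra.
  by move: ks ks2 dldl'; rewrite /h; lra.
(* Hence all these chain points lie near the finite set [Z s], whose points serve as centres. The 2
   in [3 * N + 2] pays for the moves from the grid to [s] and to [t]. *)
have xks : d (x (k s)) (x (k t)) <= eta' *+ (3 * N).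
  have := @chain_dist R T d d_sym d_tri eta' (Z s) (fun i => x (k s + i)%N)
    (k t - k s)%N.
  rewrite addn0 subnKC// => chain.
  apply: (le_trans (chain _ _ _)).
  - by rewrite (le_trans (ltW eta0)).
  - move=> i ile; have [ib1 ib2] := idl i ile.
    apply: (closeZ' _ _ sb ib1 ib2); apply: xZ.
    by case/andP: ib1.
  - move=> i ile; rewrite addnS; apply: le_trans etaeta'.
    apply: (xS _ _ _).2.
      by have [/andP[_]] := idl _ ile; rewrite addnS.
    by apply: xZ; have [/andP[_]] := idl _ (ltnW ile).
  - by apply: ler_wpMn2l; rewrite ?leq_mul2l ?sZ// (le_trans (ltW eta0)).
rewrite (le_trans (d_tri _ (x (k s)) _))// addnC mulrnDr mulr2n -addrA lerD//.
  by rewrite d_sym (le_trans fs).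
by rewrite addrC (le_trans (d_tri _ (x (k t)) _))// lerD// (le_trans ft).
Qed.

(** The approximate selections [f k], at scale 1/(k+1), share the same estimates at every fixed
    scale once [k] is large. As [Z t] is finite, [f k t] is constant along an ultrafilter; this
    constant is [r t], and the estimates pass to [r]. *)
Lemma continuous_selection (R : realType) (T : eqType) (d : T -> T -> R)
    (d_sym : forall x y, d x y = d y x)
    (d_tri : forall x y z, d x z <= d x y + d y z)
    (b : R) (N : nat) (Z : R -> seq T) :
  0 <= b -> (forall t, 0 <= t <= b -> (size (Z t) <= N)%N) ->
  (exists z, z \in Z 0) ->
  (forall eta, 0 < eta -> exists2 dl, 0 < dl &
    forall s t, 0 <= s <= b -> 0 <= t <= b -> `|s - t| < dl ->
    forall z, z \in Z t -> exists2 w, w \in Z s & d z w <= eta) ->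
  exists r : R -> T, (forall t, 0 <= t <= b -> r t \in Z t) /\
   forall eta, 0 < eta -> exists2 dl, 0 < dl &
    forall s t, 0 <= s <= b -> 0 <= t <= b -> `|s - t| < dl ->
    d (r s) (r t) <= eta.
Proof.
move=> b0 sZ Z0 closeZ.
have inv_gt0 k : 0 < k.+1%:R^-1 :> R by rewrite invr_gt0.
have /choice[f fP] : forall k : nat, exists f : R -> T,
    (forall t, 0 <= t <= b -> f t \in Z t) /\
    forall dl' eta', k.+1%:R^-1 <= dl' -> k.+1%:R^-1 <= eta' ->
   (forall s t, 0 <= s <= b -> 0 <= t <= b -> `|s - t| < dl' ->
    forall z, z \in Z t -> exists2 w, w \in Z s & d z w <= eta') ->
   forall s t, 0 <= s <= b -> 0 <= t <= b -> `|s - t| < dl' / 2 ->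
    d (f s) (f t) <= eta' *+ (3 * N + 2).
  move=> k; have [dl dl0 dlP] := closeZ _ (inv_gt0 k).
  have [||f [fZ fP]] := @grid_selection R T d d_sym d_tri b N Z
    (Num.min dl k.+1%:R^-1) _ b0 sZ Z0 _ (inv_gt0 k).
  - by rewrite lt_min dl0 inv_gt0.
  - by move=> s t sb tb; rewrite lt_min => /andP[st _]; apply: dlP.
  exists f; split => // dl' eta' dl'P eta'P.
  by apply: fP => //; rewrite ge_min dl'P orbT.
have [U [UU FU]] := ultraFilterLemma eventually_filter.
have /choice[r rP] : forall t, exists w, 0 <= t <= b ->
    w \in Z t /\ U [set k | f k t = w].
  move=> t; case: (boolP (0 <= t <= b)) => [tb|_]; last first.
    by case: Z0 => z; exists z.
  have [k|w wZ Uw] := @ultra_const U T (Z t) (f^~ t) UU; last by exists w.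
  exact: (fP k).1.
exists r; split => [t /rP[]//|eta eta0].
pose eta' := eta / (3 * N + 2)%:R.
have eta'0 : 0 < eta' by rewrite divr_gt0// ltr0n addn2.
have [dl dl0 dlP] := closeZ _ eta'0.
exists (dl / 2); first by rewrite divr_gt0.
move=> s t sb tb st.
have Ularge (e : R) : 0 < e -> U [set k | k.+1%:R^-1 <= e].
  move=> e0; apply: FU; near=> k => /=; apply: ltW.
  by near: k; exact: near_infty_natSinv_lt (PosNum e0).
have [_ Us] := rP s sb; have [_ Ut] := rP t tb.
(* A single large [k] realises both values [r s] and [r t]. *)
have [k [[/= <- <-] [/= k1 k2]]] := filter_ex
  (filterI (filterI Us Ut) (filterI (Ularge _ dl0) (Ularge _ eta'0))).
rewrite (le_trans ((fP k).2 _ _ k1 k2 dlP _ _ sb tb st))//.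
by rewrite -mulr_natr divfK// pnatr_eq0 addn2.
Unshelve. all: by end_near.
Qed.

(** * Displacement of roots *)

Lemma min_norm_mem (C : numDomainType) (r : seq C) : r != [::] ->
  exists2 w, w \in r & forall z, z \in r -> `|w| <= `|z|.
Proof.
elim: r => // a [_ _|b r /(_ isT)[w wr wmin] _].
  by exists a; rewrite ?mem_head// => z; rewrite inE => /eqP->.
have [aw|/ltW wa] := real_leP (normr_real a) (normr_real w).
  exists a; first exact: mem_head.
  by move=> z; rewrite inE => /predU1P[->//|/wmin]; apply: le_trans.
exists w; first by rewrite inE wr orbT.
by move=> z; rewrite inE => /predU1P[->//|/wmin].
Qed.

(** Multiplying by X - a replaces the coefficient b_(k+1) by b_k - a b_(k+1). Since mu <= |a|, both
    terms, weighted by mu^(k+1), are at most |a| times the inductive bound, which costs one factor 2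
    per root. *)
Lemma coef_prod_XsubC_bound (C : numDomainType) (r : seq C) (mu : C) (k : nat) :
  0 <= mu -> (forall w, w \in r -> mu <= `|w|) ->
  `|(\prod_(z <- r) ('X - z%:P))`_k| * mu ^+ k <=
    2 ^+ size r * `|(\prod_(z <- r) ('X - z%:P))`_0|.
Proof.
move=> mu0; elim: r k => [|a r IH] k mur.
  rewrite big_nil !coef1 eqxx normr1 mulr1.
  by case: k => [|k] /=; rewrite ?normr1 ?normr0 ?mul0r ?mulr1 ?ler01.
have mua : mu <= `|a| by apply: mur; rewrite mem_head.
have {}IH j : _ := IH j (fun w wr => mur w (mem_behead (s := a :: r) wr)).
rewrite big_cons /=; set Q := \prod_(j <- r) _ in IH *.
rewrite !mulrBl !coefB !coefXM !mul_polyC !coefZ/= sub0r normrN normrM exprS.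
have Q0 := le_trans (mulr_ge0 (normr_ge0 _) (exprn_ge0 0 mu0)) (IH 0%N).
case: k => [|k] /=.
  rewrite sub0r normrN normrM expr0 mulr1 ler_peMl ?mulr_ge0//.
  by rewrite -exprS exprn_ege1// ler1n.
rewrite exprS (le_trans (ler_wpM2r _ (ler_normB _ _)))//.
  by rewrite mulr_ge0// exprn_ge0.
rewrite mulrDl [2]mulr2n mulrDl mul1r mulrDl lerD//.
  rewrite mulrCA [leRHS]mulrCA ler_pM ?IH//.
  by rewrite mulr_ge0 ?exprn_ge0.
by rewrite normrM -exprS -mulrA [leRHS]mulrCA ler_wpM2l.
Qed.

(** The coefficient bound, with [mu] the least modulus of a root: a small constant coefficient
    beside a sizeable one of order [k] forces a small root. *)
Lemma small_root (C : numClosedFieldType) (B : {poly C}) (k N : nat) :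
  (size B <= N.+1)%N -> (0 < k)%N -> B`_k != 0 ->
  exists2 w, root B w & `|w| ^+ k * `|B`_k| <= 2 ^+ N * `|B`_0|.
Proof.
move=> sB k0 Bk; have B0 : B != 0 by apply: contraNneq Bk => ->; rewrite coef0.
have [r Br] := closed_field_poly_normal B.
have lB : lead_coef B != 0 by rewrite lead_coef_eq0.
have sr : size B = (size r).+1.
  by rewrite {1}Br size_scale ?size_prod_XsubC.
have [|w wr wmin] := @min_norm_mem _ r.
  apply: contraNneq Bk => r0; rewrite nth_default// sr r0.
  by rewrite (leq_trans _ k0).
exists w; first by rewrite Br rootZ// root_prod_XsubC.
have Bc i : B`_i = lead_coef B * (\prod_(z <- r) ('X - z%:P))`_i.
  by rewrite {1}Br coefZ.
rewrite !Bc !normrM mulrCA [leRHS]mulrCA ler_wpM2l// mulrC.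
rewrite (le_trans (coef_prod_XsubC_bound _ _ wmin))// ler_wpM2r//.
by rewrite ler_eXn2l ?ltr1n// -ltnS -sr.
Qed.

(** [small_root] applied to the Taylor polynomial of [A] at [z], whose roots are the differences
    [w - z]. *)
Lemma near_root (C : numClosedFieldType) (A : {poly C}) (z : C) (k N : nat) :
  (size A <= N.+1)%N -> (0 < k)%N -> A^`N(k).[z] != 0 ->
  exists2 w, root A w & `|w - z| ^+ k * `|A^`N(k).[z]| <= 2 ^+ N * `|A.[z]|.
Proof.
move=> sA k0 Ak.
have kN : (k < N.+1)%N.
  apply: contraNT Ak; rewrite -leqNgt => kN.
  by rewrite nderivn_poly0 ?horner0// (leq_trans sA).
pose B := \poly_(i < N.+1) A^`N(i).[z].
have BE i : (i < N.+1)%N -> B`_i = A^`N(i).[z] by rewrite coef_poly => ->.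
have [|w] := @small_root _ B k N (size_poly _ _) k0; first by rewrite BE.
rewrite !BE// nderivn0 => Bw wle; exists (w + z); last by rewrite addrK.
rewrite /root addrC (nderiv_taylor_wide (mulrC _ _) sA).
by move: Bw; rewrite /root horner_poly.
Qed.

(** On the disc of radius [rho], the Taylor coefficient of order [d] is at most [K] times a bound on
    the coefficients of [E]; the size bound makes [K] uniform in [E]. *)
Lemma horner_nderivn_small (C : numFieldType) (N d : nat) (rho eps : C) :
  0 <= rho -> 0 < eps -> exists2 dl, 0 < dl & forall E : {poly C},
    (size E <= N)%N -> (forall j, `|E`_j| <= dl) ->
    forall z : C, `|z| <= rho -> `|E^`N(d).[z]| <= eps.
Proof.
move=> rho0 eps0; pose K := \sum_(i < N) 'C(d + i, d)%:R * rho ^+ i.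
have K0 : 0 <= K by apply: sumr_ge0 => i _; rewrite mulr_ge0// exprn_ge0.
have K1 : 0 < K + 1 by rewrite ltr_wpDl.
exists (eps / (K + 1)); first by rewrite divr_gt0.
move=> E sE Ele z zrho.
have sE' : (size E^`N(d) <= N)%N.
  apply/leq_sizeP => j Nj; rewrite coef_nderivn nth_default ?mul0rn//.
  by rewrite (leq_trans sE)// (leq_trans Nj) ?leq_addl.
rewrite (horner_coef_wide _ sE') (le_trans (ler_norm_sum _ _ _))//.
apply: (@le_trans _ _ (eps / (K + 1) * K)); last first.
  by rewrite -mulrA ler_piMr ?(ltW eps0)// mulrC ler_pdivrMr// mul1r lerDl.
rewrite mulr_sumr ler_sum// => i _.
rewrite normrM normrX coef_nderivn normrMn -(mulr_natr `|_|) -[leLHS]mulrA.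
apply: ler_pM; rewrite ?mulr_ge0 ?exprn_ge0 ?ler0n ?Ele//.
by rewrite ler_wpM2l// lerXn2r ?nnegrE.
Qed.

(** Heine-Cantor, through the near-covering form of compactness. The norm is valued in [K] so that
    [V] may be [R[i]] over itself. *)
Lemma segment_unif_continuous (R : realType) (K : numFieldType)
    (V : pseudoMetricNormedZmodType K) (a b : R) (f : R -> V) :
  {within `[a, b], continuous f} -> forall eps : K, 0 < eps ->
  exists2 dl : R, 0 < dl & forall s t, a <= s <= b -> a <= t <= b ->
    `|s - t| < dl -> `|f s - f t| < eps.
Proof.
move=> /subspace_continuousP cf eps eps0.
pose P (dl x : R) := a <= x <= b -> forall y, a <= y <= b -> `|x - y| < dl ->
  `|f x - f y| < eps.
have /compact_near_coveringP/(_ R 0^'+ P _) cov := @segment_compact R a b.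
have : \forall dl \near 0^'+, `[a, b]%classic `<=` P dl.
  apply: cov => x xab.
  have /cvgrPdist_lt/(_ (eps / 2)) := cf _ xab.
  rewrite divr_gt0// => /(_ isT); rewrite near_withinE => -[e /= e0 eP].
  have near_x y : `|x - y| < e -> a <= y <= b -> `|f x - f y| < eps / 2.
    by move=> xy yab; apply: eP; rewrite //= in_itv.
  exists (ball x (e / 2), [set dl | 0 < dl < e / 2]).
    split=> /=; first by apply: nbhsx_ballx; rewrite divr_gt0.
    near=> dl; apply/andP; split; near: dl; first exact: nbhs_right_gt.
    by apply: nbhs_right_lt; rewrite divr_gt0.
  move=> [x' dl] [/= xx' /andP[dl0 dle]] x'ab y yab x'y.
  rewrite -(subrK (f x) (f x')) -addrA [eps]splitr.
  rewrite (le_lt_trans (ler_normD _ _))// ltrD//.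
    rewrite distrC near_x//; apply: lt_le_trans xx' _.
    by rewrite ler_pdivrMr// ler_peMr ?(ltW e0)// ler1n.
  apply: near_x => //; rewrite -(subrK x' x) -addrA [e]splitr.
  by rewrite (le_lt_trans (ler_normD _ _))// ltrD// (lt_trans x'y).
move=> nearP; near (0 : R)^'+ => dl; exists dl.
  by near: dl; exact: nbhs_right_gt.
move=> s t sab tab st; have := near nearP dl _ s; apply => //.
Unshelve. all: by end_near.
Qed.

Local Open Scope complex_scope.

(** * Continuous factorization *)

Section Croots.
Variable R : realType.
Implicit Types (q : {poly R[i]}) (z : R[i]).

Lemma crootsE q : q = lead_coef q *: \prod_(z <- croots q) ('X - z%:P).
Proof. by rewrite /croots; case: closed_field_poly_normal. Qed.

Lemma size_croots q : q != 0 -> size (croots q) = (size q).-1.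
Proof.
move=> q0; rewrite {2}(crootsE q) size_scale ?lead_coef_eq0//.
by rewrite size_prod_XsubC.
Qed.

Lemma mem_croots q z : q != 0 -> (z \in croots q) = root q z.
Proof.
move=> q0; rewrite [in RHS](crootsE q) rootZ ?lead_coef_eq0//.
by rewrite root_prod_XsubC.
Qed.

(** The norm of [R[i]] is valued in [R[i]]; [complex.Re] brings it back to [R] without loss. *)
Lemma Re_normE z : (complex.Re `|z|)%:C = `|z|.
Proof. by rewrite RRe_real ?normr_real. Qed.

Lemma Re_norm_le z (x : R) : (complex.Re `|z| <= x) = (`|z| <= x%:C).
Proof. by rewrite -lecR Re_normE. Qed.

End Croots.

Definition coef_continuous (R : realType) (b : R) (A : R -> {poly R[i]}) :=
  forall j, {within `[0, b], continuous (fun t => (A t)`_j)}.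

Lemma coef_continuous_unif (R : realType) (b : R) (A : R -> {poly R[i]})
    (N : nat) (eps : R[i]) :
  coef_continuous b A -> (forall t, (size (A t) <= N)%N) -> 0 < eps ->
  exists2 dl : R, 0 < dl & forall s t, 0 <= s <= b -> 0 <= t <= b ->
    `|s - t| < dl -> forall j, `|(A s - A t)`_j| <= eps.
Proof.
move=> cA sA eps0.
have [dl dl0 dlP] : exists2 dl : R, 0 < dl & forall s t, 0 <= s <= b ->
    0 <= t <= b -> `|s - t| < dl ->
    forall j, (j < N)%N -> `|(A s)`_j - (A t)`_j| <= eps.
  elim: N {sA} => [|N [dl dl0 dlP]]; first by exists 1.
  have [dl' dl'0 dl'P] := segment_unif_continuous (cA N) eps0.
  exists (Num.min dl dl'); first by rewrite lt_min dl0.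
  move=> s t sb tb; rewrite lt_min => /andP[st1 st2] j.
  by rewrite ltnS leq_eqVlt => /predU1P[->|]; [exact/ltW/dl'P|exact: dlP].
exists dl => // s t sb tb st j; rewrite coefB.
have [jN|Nj] := ltnP j N; first exact: dlP.
by rewrite !nth_default ?subrr ?normr0 ?(ltW eps0)// (leq_trans (sA _)).
Qed.

Lemma unif_continuous_within (R : realType) (b : R) (r : R -> R[i]) :
  (forall eta : R, 0 < eta -> exists2 dl, 0 < dl &
    forall s t, 0 <= s <= b -> 0 <= t <= b -> `|s - t| < dl ->
    complex.Re `|r s - r t| <= eta) ->
  {within `[0, b], continuous r}.
Proof.
move=> rP; apply/subspace_continuousP => x; rewrite /= in_itv/= => xb.
apply/cvgrPdist_le => eps eps0; rewrite near_withinE.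
have epsE : (complex.Re eps)%:C = eps by rewrite RRe_real// gtr0_real.
have /rP[dl dl0 dlP] : 0 < complex.Re eps by rewrite -ltcR epsE.
exists dl => //= y xy; rewrite in_itv/= => yb.
by rewrite -epsE -Re_norm_le; apply: dlP.
Qed.

Lemma nderivn_lead (R : nzRingType) (p : {poly R}) :
  p^`N((size p).-1) = (lead_coef p)%:P.
Proof.
apply/polyP => -[|i]; rewrite coef_nderivn coefC/=.
  by rewrite addn0 binn mulr1n.
rewrite nth_default ?mul0rn//; case: (size p) => //= n.
by rewrite addnS ltnS leq_addr.
Qed.

(* Near [t = 0] the Taylor coefficient of order [deg (A 0)] of [A t] is bounded
   away from zero on bounded sets, so [near_root] bounds the displacement of the
   bounded roots, whatever the degree of [A t]. *)
Lemma continuous_root (R : realType) (b : R) (A : R -> {poly R[i]}) (N : nat) :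
  0 < b -> coef_continuous b A -> (forall t, (size (A t) <= N.+1)%N) ->
  (1 < size (A 0%R))%N ->
  exists (b' : R) (r : R -> R[i]), [/\ 0 < b' <= b,
    {within `[0, b'], continuous r}
    & forall t, 0 <= t <= b' -> root (A t) (r t)].
Proof.
move=> b0 cA sA sA0.
set d := (size (A 0)).-1; set L := lead_coef (A 0).
have d0 : (0 < d)%N by rewrite /d -subn1 subn_gt0.
have A0 : A 0 != 0 by rewrite -size_poly_gt0 ltnW.
have L0 : 0 < `|L| by rewrite normr_gt0 lead_coef_eq0.
have dL z : (A 0)^`N(d).[z] = L by rewrite nderivn_lead hornerC.
pose rho0 : R[i] := \sum_(z <- croots (A 0)) `|z|.
have rho0_ge0 : 0 <= rho0 by apply: sumr_ge0.
have rho0P z : root (A 0) z -> `|z| <= rho0.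
  rewrite -mem_croots// => zA; rewrite /rho0 (big_rem z)//= lerDl.
  exact: sumr_ge0.
(* For small [t], a root of [A t] in the disc of radius [rho] is within 1 of a root of [A 0], so of
   modulus at most [rho0 + 1]; a displacement by at most 1 then keeps it in the disc. *)
pose rho := rho0 + 2.
have rho_ge0 : 0 <= rho by rewrite addr_ge0.
have sAB (s t : R) : (size (A s - A t)%R <= N.+1)%N.
  by rewrite (leq_trans (size_polyD _ _))// size_polyN geq_max !sA.
have zero_b : 0 <= (0 : R) <= b by rewrite lexx ltW.
have L2 : 0 < `|L| / 2 by rewrite divr_gt0.
have [e1 e10 e1P] : exists2 e1 : R, 0 < e1 & forall s, 0 <= s <= b -> s < e1 ->
    forall z, `|z| <= rho -> `|L| / 2 <= `|(A s)^`N(d).[z]|.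
  have [dl dl0 dlP] := horner_nderivn_small N.+1 d rho_ge0 L2.
  have [e1 e10 e1P] := coef_continuous_unif cA sA dl0.
  exists e1 => // s sb se z zrho.
  have : `|(A s - A 0)^`N(d).[z]| <= `|L| / 2.
    apply: dlP => //.
    by apply: e1P => //; rewrite subr0 ger0_norm//; case/andP: sb.
  rewrite nderivnB hornerD hornerN dL distrC => /(le_trans (lerB_dist _ _)).
  by rewrite lerBlDr addrC -lerBlDr {1}[`|L|]splitr addrK.
have closeA (eta : R) : 0 < eta -> exists2 e : R, 0 < e &
    forall s t, 0 <= s <= b -> s < e1 -> 0 <= t <= b -> `|s - t| < e ->
    forall z, `|z| <= rho -> root (A t) z ->
    exists2 w, root (A s) w & `|w - z| <= eta%:C.
  move=> eta0; have eta0' : 0 < eta%:C :> R[i] by rewrite ltcR.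
  (* With this bound on [(A s).[z]], the right-hand side of [near_root] is at most
     [|L| / 2 * eta ^+ d], so the displacement is at most [eta]. *)
  have [||dl dl0 dlP] :=
    @horner_nderivn_small _ N.+1 0 rho (`|L| / 2 * eta%:C ^+ d / 2 ^+ N).
  - exact: rho_ge0.
  - by rewrite divr_gt0 ?exprn_gt0// mulr_gt0 ?exprn_gt0.
  have [e e0 eP] := coef_continuous_unif cA sA dl0.
  exists e => // s t sb se1 tb st z zrho Atz.
  have Lz := e1P s sb se1 z zrho.
  have Lz0 : 0 < `|(A s)^`N(d).[z]| := lt_le_trans L2 Lz.
  have [|w Asw wz] := near_root (sA s) d0 (z := z); first by rewrite -normr_gt0.
  exists w => //; rewrite -(@ler_pXn2r _ d)// ?nnegrE// ?(ltW eta0')//.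
  rewrite -(ler_pM2r L2) (le_trans (ler_wpM2l _ Lz)) ?exprn_ge0//.
  rewrite (le_trans wz)// mulrC -ler_pdivlMr ?exprn_gt0// [_ ^+ d * _]mulrC.
  have -> : (A s).[z] = (A s - A t)^`N(0).[z].
    by rewrite nderivn0 hornerD hornerN (rootP Atz) subr0.
  by apply: dlP => //; exact: eP.
have [e2 e20 e2P] := closeA 1 ltr01.
pose b' := Num.min b (Num.min (e1 / 2) (e2 / 2)).
have b'0 : 0 < b' by rewrite !lt_min b0 !divr_gt0.
have b'b : b' <= b by rewrite ge_min lexx.
have half_lt (e : R) : 0 < e -> e / 2 < e.
  by move=> e0; rewrite ltr_pdivrMr// ltr_pMr// ltr1n.
have b'e1 : b' < e1.
  by rewrite (le_lt_trans _ (half_lt _ e10))// !ge_min lexx orbT.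
have b'e2 : b' < e2.
  by rewrite (le_lt_trans _ (half_lt _ e20))// !ge_min lexx !orbT.
have inb t : 0 <= t <= b' -> 0 <= t <= b.
  by move=> /andP[-> tb']; rewrite (le_trans tb').
have ine1 t : 0 <= t <= b' -> t < e1.
  by move=> /andP[_ tb']; rewrite (le_lt_trans tb').
have A_neq0 t : 0 <= t <= b' -> A t != 0.
  move=> tb'; have := e1P t (inb _ tb') (ine1 _ tb') 0.
  rewrite normr0 => /(_ rho_ge0) /(lt_le_trans L2); apply: contraTneq => ->.
  by rewrite linear0 horner0 normr0 ltxx.
have stay t z : 0 <= t <= b' -> `|z| <= rho -> root (A t) z -> `|z| <= rho0 + 1.
  move=> tb' zrho Atz.
  have [|w A0w] := e2P 0 t zero_b e10 (inb _ tb') _ z zrho Atz.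
    rewrite sub0r normrN ger0_norm; last by case/andP: tb'.
    by apply: le_lt_trans b'e2; case/andP: tb'.
  rewrite distrC => zw; rewrite -[z](subrK w) (le_trans (ler_normD _ _))//.
  by rewrite addrC lerD// rho0P.
(* Only the roots in the disc are followed; [A t] may have others, which escape to infinity. *)
pose Z t := [seq z <- croots (A t) | `|z| <= rho].
have ZP t z : 0 <= t <= b' -> (z \in Z t) = (`|z| <= rho) && root (A t) z.
  by move=> tb'; rewrite mem_filter mem_croots// A_neq0.
have zero_b' : 0 <= (0 : R) <= b' by rewrite lexx ltW.
have [|||||r [rZ rc]] := @continuous_selection R R[i]
    (fun z w => complex.Re `|z - w|) _ _ b' N Z (ltW b'0).
- by move=> z w; rewrite distrC.
- by move=> x y z; rewrite -lecR rmorphD/= !Re_normE ler_distD.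
- move=> t tb'; rewrite size_filter (leq_trans (count_size _ _))//.
  by rewrite size_croots ?A_neq0// -subn1 leq_subLR add1n.
- have /closed_rootP[z Az] : size (A 0) != 1%N by rewrite gtn_eqF.
  exists z; rewrite ZP// Az andbT (le_trans (rho0P _ Az))//.
  by rewrite /rho lerDl.
(* The cap by 1 keeps the displaced root in the disc. *)
- move=> eta eta0; pose eta1 := Num.min eta 1.
  have eta10 : 0 < eta1 by rewrite lt_min eta0 ltr01.
  have [e e0 eP] := closeA eta1 eta10.
  exists e => // s t sb' tb' st z; rewrite ZP// => /andP[zrho Atz].
  have [w Asw wz] := eP s t (inb _ sb') (ine1 _ sb') (inb _ tb') st z zrho Atz.
  exists w.
    rewrite ZP// Asw andbT -[w](subrK z) (le_trans (ler_normD _ _))// /rho.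
    rewrite [2](_ : _ = 1 + 1)// addrA addrC lerD ?(stay t)//.
    by rewrite (le_trans wz)// -[1]/(1%:C) lecR ge_min lexx orbT.
  by rewrite Re_norm_le distrC (le_trans wz)// lecR ge_min lexx.
exists b', r; split; first by rewrite b'0.
- exact: unif_continuous_within.
- by move=> t tb'; have := rZ t tb'; rewrite ZP// => /andP[].
Qed.

(** Horner's recursion Q_j = A_(j+1) + r Q_(j+1), run downwards from the vanishing coefficients of
    index at least [N], involves only sums and products. *)
Lemma coef_continuous_quotient (R : realType) (b : R)
    (A Q : R -> {poly R[i]}) (r : R -> R[i]) (N : nat) :
  coef_continuous b A -> {within `[0, b], continuous r} ->
  (forall t, (size (Q t) <= N)%N) ->
  (forall t, 0 <= t <= b -> A t = Q t * ('X - (r t)%:P)) ->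
  coef_continuous b Q.
Proof.
move=> cA cr sQ AQ.
suff cQ k j : (N <= j + k)%N ->
    {within `[0, b], continuous (fun t => (Q t)`_j)}.
  by move=> j; apply: (cQ N); rewrite leq_addl.
elim: k j => [|k IH] j Nj.
  rewrite (_ : (fun t => _) = cst 0); first exact: cst_continuous.
  by apply/funext => t; rewrite nth_default// (leq_trans (sQ t)) -1?(addn0 j).
have cQS : {within `[0, b], continuous
    (fun t => (A t)`_j.+1 + r t * (Q t)`_j.+1)}.
  by move=> x; apply: cvgD; [exact: cA|apply: cvgM; [exact: cr|
    apply: IH; rewrite addSnnS]].
apply: subspace_eq_continuous cQS => t; rewrite inE/= in_itv/= => tb.
rewrite /from_subspace /= (AQ t tb) mulrBr coefB coefMX coefMC /=.
by rewrite mulrC subrK.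
Qed.

Lemma coef_continuousW (R : realType) (b b' : R) (A : R -> {poly R[i]}) :
  b' <= b -> coef_continuous b A -> coef_continuous b' A.
Proof.
move=> b'b cA j; apply: continuous_subspaceW (cA j).
by apply: subset_itvl; rewrite bnd_simp.
Qed.

(** Each continuous root split off lowers the degree of [A 0] by one. For t > 0 the cofactor [G t]
    keeps the other roots of [A t], so its degree may be positive although [G 0] is constant. *)
Lemma continuous_factorization (R : realType) (d N : nat) (b : R)
    (A : R -> {poly R[i]}) :
  0 < b -> coef_continuous b A -> (forall t, (size (A t) <= N.+1)%N) ->
  size (A 0) = d.+1 ->
  exists (b' : R) (r : nat -> R -> R[i]) (G : R -> {poly R[i]}),
  [/\ 0 < b' <= b, forall i, {within `[0, b'], continuous (r i)},
      coef_continuous b' G /\ forall t, (size (G t) <= N.+1)%N,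
      size (G 0) = 1%N
    & forall t, 0 <= t <= b' ->
        A t = \prod_(i < d) ('X - (r i t)%:P) * G t].
Proof.
elim: d b A => [|d IH] b A b0 cA sA sA0.
  exists b, (fun _ => cst 0), A; split.
  - by rewrite b0/=.
  - by move=> i; exact: cst_continuous.
  - by split; [exact: cA|exact: sA].
  - exact: sA0.
  - by move=> t _; rewrite big_ord0 mul1r.
have [|b1 [r0 [/andP[b10 b1b] cr0 r0P]]] := continuous_root b0 cA sA.
  by rewrite sA0.
(* Outside [[0, b1]] this is a mere Euclidean quotient, which suffices for the size bound. *)
pose Q t := A t %/ ('X - (r0 t)%:P).
have QE t : 0 <= t <= b1 -> A t = Q t * ('X - (r0 t)%:P).
  by move=> tb; rewrite divpK// dvdp_XsubCl r0P.
have sQE t : size (Q t) = (size (A t)).-1.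
  by rewrite size_divp ?polyXsubC_eq0// size_XsubC subn1.
have sQ t : (size (Q t) <= N.+1)%N.
  by rewrite sQE (leq_trans (leq_pred _)).
have cQ : coef_continuous b1 Q.
  exact: coef_continuous_quotient (coef_continuousW b1b cA) cr0 sQ QE.
have [|b2 [r [G [/andP[b20 b2b] cr cGsG G0 GE]]]] := IH b1 Q b10 cQ sQ.
  by rewrite sQE sA0.
exists b2, (fun i => if i is j.+1 then r j else r0), G; split.
- by rewrite b20 (le_trans b2b).
- case=> [|i]; last exact: cr.
  apply: continuous_subspaceW cr0.
  by apply: subset_itvl; rewrite bnd_simp.
- exact: cGsG.
- exact: G0.
- move=> t tb; have tb1 : 0 <= t <= b1.
    by have /andP[-> tb2] := tb; exact: le_trans b2b.
  by rewrite (QE t tb1) (GE t tb) big_ord_recl/= mulrC mulrA.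
Qed.

(** * Min-plus roots *)

Section MinPlusRoots.
Variable R : realType.
Implicit Types (P : {poly Rmin R}) (d : Rmin R) (cs : seq (Rmin R)) (a c h : R).

Lemma rmin_finX a j : rmin_fin a ^+ j = rmin_fin (a *+ j).
Proof.
elim: j => [|j IH]; first by rewrite expr0 mulr0n.
by rewrite exprS IH mulrS; apply/val_inj.
Qed.

Lemma horner_rmin_le P d j :
  (rmin_val P.[d] <= rmin_val (P`_j * d ^+ j)%R)%E.
Proof.
have [Pj|jP] := leqP (size P) j.
  by rewrite [P`_j]nth_default// mul0r leey.
rewrite horner_coef (bigD1 (Ordinal jP))//=.
by rewrite ge_min lexx.
Qed.

(** [fine] loses nothing: the minimum is real, as [a] is real and [rmin_val d] is not -oo. *)
Definition trunc_at a d : R := fine (Order.min a%:E (rmin_val d)).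

Lemma rmin_fin_add a d : rmin_fin a + d = rmin_fin (trunc_at a d).
Proof.
apply/val_inj; rewrite /= /trunc_at.
case: d => [[r| |] //= _]; last by rewrite min_l ?leey.
by rewrite -EFin_min.
Qed.

(** A non-zero leading coefficient is a real number, so on the reals the factored form is a
    real-valued function, to which slope computations apply. *)
Lemma minplus_rootsE P cs : minplus_roots P cs ->
  exists L, forall a,
    P.[rmin_fin a] = rmin_fin (L + \sum_(d <- cs) trunc_at a d).
Proof.
case=> P0 _ _ Pcs; have lP : lead_coef P != 0 by rewrite lead_coef_eq0.
have [L LE] : exists L, lead_coef P = rmin_fin L.
  case: (lead_coef P) lP => [[r| |] Hr] lP //.
  by exists r; apply/val_inj.
exists L => a; rewrite Pcs LE.
elim: cs {Pcs} => [|d cs IH]; first by rewrite !big_nil addr0 mulr1.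
rewrite !big_cons rmin_fin_add mulrCA IH addrCA.
by apply/val_inj.
Qed.

(** Isolates [c] among the roots, so that the polynomial function is affine on [c - h, c] and on
    [c, c + h]. *)
Lemma root_gap cs c : exists2 h, 0 < h & forall d, d \in cs ->
  ((rmin_val d < c%:E)%E -> (rmin_val d <= (c - h)%:E)%E) /\
  ((c%:E < rmin_val d)%E -> ((c + h)%:E <= rmin_val d)%E).
Proof.
elim: cs => [|d cs [h h0 hP]]; first by exists 1.
have [h' h'0 [h'1 h'2]] : exists2 h, 0 < h &
  ((rmin_val d < c%:E)%E -> (rmin_val d <= (c - h)%:E)%E) /\
  ((c%:E < rmin_val d)%E -> ((c + h)%:E <= rmin_val d)%E).
  case: d => [[r| |] //= _]; last by exists 1 => //; split => // _; exact: leey.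
  have [->|rc] := eqVneq r c; first by exists 1; rewrite ?ltxx.
  exists `|r - c|; first by rewrite normr_gt0 subr_eq0.
  rewrite !lte_fin !lee_fin; split => [rltc|cltr].
    by rewrite ltr0_norm ?subr_lt0//; lra.
  by rewrite gtr0_norm ?subr_gt0//; lra.
exists (Num.min h h'); first by rewrite lt_min h0.
move=> x; rewrite inE => /predU1P[->|/hP[x1 x2]]; split => xc.
- by rewrite (le_trans (h'1 xc))// lee_fin lerB// ge_min lexx orbT.
- by rewrite (le_trans _ (h'2 xc))// lee_fin lerD// ge_min lexx orbT.
- by rewrite (le_trans (x1 xc))// lee_fin lerB// ge_min lexx.
- by rewrite (le_trans _ (x2 xc))// lee_fin lerD// ge_min lexx.
Qed.

(* The line [P_j + j y] touches the graph of [\hat P] from above at [c]. *)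
Lemma minimal_term_bounds P cs c j : minplus_roots P cs ->
  P.[rmin_fin c] = P`_j * rmin_fin c ^+ j ->
  (count (fun d => (c%:E < rmin_val d)%E) cs <= j <=
    count (fun d => (c%:E < rmin_val d)%E) cs + count_mem (rmin_fin c) cs)%N.
Proof.
move=> Pcs Pj; set m' := count _ cs; set m := count_mem _ cs.
have [L LE] := minplus_rootsE Pcs.
pose S a := \sum_(d <- cs) trunc_at a d.
(* The term [j] is nowhere below the polynomial function and equals it at [c]. *)
have SE a : S a - S c <= (a - c) *+ j.
  have := horner_rmin_le P (rmin_fin a) j; move: Pj; rewrite !LE !rmin_finX.
  case: (P`_j) => [[pj| |] Hpj] // /(congr1 (@rmin_val R))//= [LSc].
  by rewrite lee_fin mulrnBl -/(S a); move: LSc; rewrite -/(S c); lra.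
have [h h0 hP] := root_gap cs c.
(* Slope on the right of [c]: each root greater than [c] contributes 1, the others 0. *)
have Sright : S (c + h) - S c = h *+ m'.
  rewrite /S /m' -sumrB; elim: cs hP {Pcs LE S SE m m'} => [|d cs IH] hP.
    by rewrite big_nil.
  rewrite big_cons IH => [|x xcs]; last by apply: hP; rewrite inE xcs orbT.
  rewrite /= mulrnDr; congr (_ + _); have [d1 d2] := hP d (mem_head _ _).
  rewrite /trunc_at; have [cd|dc] := ltP.
    by rewrite (min_l (d2 cd))/= addrAC subrr add0r.
  by rewrite min_r ?subrr// (le_trans dc)// lee_fin lerDl ltW.
(* On the left, the roots equal to [c] contribute as well. *)
have Sleft : S (c - h) - S c = - (h *+ (m' + m)).
  rewrite /S /m' /m -sumrB.
  elim: cs hP {Pcs LE S SE m m' Sright} => [|d cs IH] hP.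
    by rewrite big_nil oppr0.
  rewrite big_cons /= addnACA mulrnDr opprD IH => [|x xcs]; last first.
    by apply: hP; rewrite inE xcs orbT.
  congr (_ + _).
  have [d1 d2] := hP d (mem_head _ _).
  have chc : ((c - h)%:E <= c%:E)%E by rewrite lee_fin gerBl ltW.
  rewrite -val_eqE/= /trunc_at; have [cd|dc|dc] := ltgtP.
  - rewrite min_l ?(le_trans chc (ltW cd))//=.
    by rewrite addn0 addrAC subrr add0r mulr1n.
  - by rewrite addn0 mulr0n oppr0 (min_r (d1 dc)) subrr.
  - by rewrite -dc min_l//= addrAC subrr add0r mulr1n.
have := SE (c + h); have := SE (c - h).
rewrite Sleft Sright [c - h]addrC [c + h]addrC !addrK mulNrn lerN2.
by rewrite !ler_pMn2l// => -> ->.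
Qed.

End MinPlusRoots.

(** * Valuation and root multiset of a complex polynomial *)

Section PolyVal.
Variable R : realType.
Implicit Types (q G : {poly R[i]}).

Lemma poly_valE q k : (forall i, (i < k)%N -> q`_i = 0) -> q`_k != 0 ->
  poly_val q = k.
Proof.
move=> q0 qk; apply/eqP; rewrite eqn_leq; apply/andP; split.
  by rewrite leqNgt; apply: contra qk => /(before_find 0)/negbFE.
rewrite leqNgt; apply/negP => fk.
have : has (fun a => a != 0) q.
  rewrite has_find (ltn_trans fk)// ltnNge; apply: contra qk => sq.
  by rewrite nth_default.
by move=> /(nth_find 0); rewrite q0 ?eqxx.
Qed.

(** Gathering the zero roots leaves a power of X times a factor that does not vanish at 0. *)
Lemma poly_val_croots q : q != 0 -> poly_val q = count_mem 0 (croots q).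
Proof.
move=> q0; pose s := [seq z <- croots q | z != 0].
pose Q := \prod_(z <- s) ('X - z%:P).
have qE : q = lead_coef q *: (Q * 'X^(count_mem 0 (croots q))).
  rewrite {1}(crootsE q) (bigID (fun z => z != 0))/= -big_filter -/s -/Q.
  congr (_ *: (_ * _)); elim: (croots q) => [|z r IH]; first by rewrite big_nil.
  rewrite big_cons negbK IH /=; case: eqP => [->|_]; last by rewrite add0n.
  by rewrite subr0 add1n exprS.
apply: poly_valE => [i ik|]; rewrite {1}qE coefZ coefMXn ?ik ?mulr0//.
rewrite ltnn subnn mulf_neq0 ?lead_coef_eq0// -horner_coef0.
by rewrite -/(root _ _) root_prod_XsubC mem_filter eqxx.
Qed.

Lemma croots_prod (s : seq R[i]) G : G != 0 ->
  perm_eq (croots (\prod_(z <- s) ('X - z%:P) * G)) (s ++ croots G).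
Proof.
move=> G0; apply: prod_XsubC_eq; rewrite big_cat/=.
set q := _ * G; have lq : lead_coef q = lead_coef G.
  by rewrite lead_coefM (monicP (monic_prod_XsubC _ _ _)) mul1r.
have lG : lead_coef G != 0 by rewrite lead_coef_eq0.
apply: (scalerI lG); rewrite -{1}lq -crootsE scalerAr -crootsE//.
Qed.

End PolyVal.

(** * Asymptotics of roots *)

Section Asymptotics.
Variable R : realType.
Implicit Types (f r : R -> R[i]) (a : R[i]) (b c s : R).

Lemma norm_realC (x : R) : `|x%:C| = `|x|%:C :> R[i].
Proof. by rewrite normc_def /= expr0n addr0 sqrtr_sqr. Qed.

Lemma cvg_realC (T : Type) (F : set_system T) (FF : Filter F) (g : T -> R)
    (l : R) :
  g x @[x --> F] --> l -> (g x)%:C @[x --> F] --> l%:C.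
Proof.
move=> gl; apply/cvgrPdist_le => eps eps0.
have epsE : (complex.Re eps)%:C = eps by rewrite RRe_real// gtr0_real.
have Re0 : 0 < complex.Re eps by rewrite -ltcR epsE.
have /cvgrPdist_le/(_ _ Re0) := gl; apply: filterS => x gx.
by rewrite -rmorphB norm_realC -epsE lecR.
Qed.

Lemma powR_continuous s (t : R) : 0 < t -> {for t, continuous (@powR R ^~ s)}.
Proof.
move=> t0; apply/differentiable_continuous; apply/derivable1_diffP.
by apply: derivable_powR; rewrite in_itv/= t0.
Qed.

(** If A = x is real, t^s f = t^(x+s) (t^(-x) f), where the first factor is 1 or tends to 0
    according as x + s is zero or positive. *)
Lemma rescaled_cvg f a (A : Rmin R) s : simeq_asym f a A ->
  (forall x, rmin_val A = x%:E -> 0 <= x + s) ->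
  (t `^ s)%:C * f t @[t --> 0^'+] -->
    (if rmin_val A == (- s)%:E then a else 0).
Proof.
rewrite /simeq_asym; case: (rmin_val A) (rmin_valP A) => [x|_|]; last first.
- by move=> /negP[].
- move=> f0 _ /=; apply: cvg_trans (near_eq_cvg _) (cvg_cst 0).
  by apply: filterS f0 => t ->; rewrite mulr0.
- move=> _ fa /(_ x erefl); rewrite eqe -subr_eq0 opprK => xs0.
  have fE : \forall t \near 0^'+, (t `^ (x + s))%:C * ((t `^ - x)%:C * f t) =
      (t `^ s)%:C * f t.
    near=> t; rewrite mulrA -rmorphM /= -powRD; last first.
      by apply/implyP => _; rewrite gt_eqF//; near: t; exact: nbhs_right_gt.
    by rewrite addrAC subrr add0r.
  apply: cvg_trans (near_eq_cvg fE) _.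
  have [xs|xs] := eqVneq (x + s) 0.
    by under eq_fun do rewrite xs powRr0 mul1r.
  have t0 : (t `^ (x + s))%:C @[t --> 0^'+] --> (0 : R[i]).
    by apply: cvg_realC; apply: powR_cvg0; rewrite lt_neqAle eq_sym xs.
  by have := cvgM t0 fa; rewrite mul0r; apply.
Unshelve. all: by end_near.
Qed.

Lemma within_continuous_extend0 f a b : 0 < b ->
  (forall t, 0 < t <= b -> {for t, continuous f}) ->
  f t @[t --> 0^'+] --> a ->
  {within `[0, b], continuous (fun t => if 0 < t then f t else a)}.
Proof.
move=> b0 cf fa; set g : R -> R[i] := fun t => if 0 < t then f t else a.
have gf (t : R) : 0 < t -> \forall x \near t, f x = g x.
  move=> t0; near=> x; rewrite /g ifT//; near: x.
  exact: lt_nbhsr.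
have cg (t : R) : 0 < t <= b -> g x @[x --> t] --> g t.
  move=> tb; have t0 : 0 < t by case/andP: tb.
  rewrite {2}/g t0; apply: cvg_trans (near_eq_cvg (gf t t0)) _.
  exact: cf.
apply/(continuous_within_itvP _ b0); split.
- by move=> t; rewrite in_itv/= => /andP[t0 /ltW tb]; apply: cg; rewrite t0.
- rewrite {2}/g ltxx; apply: cvg_trans (near_eq_cvg _) fa.
  near=> x; rewrite /g ifT//; near: x; exact: nbhs_right_gt.
- by apply: cvg_at_left_filter; apply: cg; rewrite b0/=.
Unshelve. all: by end_near.
Qed.

Lemma common_germ_domain n (PP : nat -> R -> R[i]) :
  (forall j, (j <= n)%N -> in_germs (PP j)) ->
  exists2 e0 : R, 0 < e0 & forall j, (j <= n)%N -> forall t, 0 < t < e0 ->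
    {for t, continuous (PP j)}.
Proof.
elim: n => [|n IH] hPP.
  have [e0 [e00 ce _]] := hPP 0%N (leqnn _).
  exists e0; [exact: e00|move=> j; rewrite leqn0 => /eqP-> t te].
  by apply: ce; rewrite in_itv.
have [j jn|e1 e10 e1P] := IH; first by apply: hPP; rewrite leqW.
have [e2 [e20 e2P _]] := hPP n.+1 (leqnn _).
exists (Num.min e1 e2); first by rewrite lt_min e10.
move=> j; rewrite leq_eqVlt => jn t; rewrite lt_min => /and3P[t0 te1 te2].
case/predU1P: jn => [->|jn]; first by apply: e2P; rewrite in_itv/= t0.
by apply: e1P jn _ _; rewrite t0.
Qed.

(** Near 0, |r| is at most |r(0)| + 1, hence at most 1/t, while t^c <= t^(-|c|) for t < 1; whence
    the exponent |c| + 1. *)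
Lemma in_germs_scaled b c r : 0 < b -> {within `[0, b], continuous r} ->
  in_germs (fun t => (t `^ c)%:C * r t).
Proof.
move=> b0 cr; have /(continuous_within_itvP _ b0)[cr1 cr2 _] := cr.
have r0 : 0 < complex.Re `|r 0| + 1.
  by rewrite ltr_wpDl// -ler0c Re_normE.
have [e1 e10 e1P] : exists2 e1 : R, 0 < e1 & forall t, 0 < t < e1 ->
    `|r t| <= (complex.Re `|r 0| + 1)%:C.
  have /cvgrPdist_le/(_ 1 ltr01) := cr2.
  rewrite near_withinE => -[e1 /= e10 e1P]; exists e1 => // t /andP[t0 te].
  have /e1P : ball 0 e1 t by rewrite /ball/= sub0r normrN gtr0_norm.
  move=> /(_ t0) rt; rewrite -[r t](subrK (r 0)) (le_trans (ler_normD _ _))//.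
  by rewrite rmorphD/= Re_normE addrC lerD// distrC.
pose e0 := Num.min (Num.min b e1) (Num.min 1 (complex.Re `|r 0| + 1)^-1).
exists e0; split.
- by rewrite !lt_min b0 e10 ltr01 invr_gt0.
- move=> t; rewrite in_itv/= !lt_min => /andP[t0 /andP[/andP[tb _] _]].
  apply: cvgM; last by apply: cr1; rewrite in_itv/= t0.
  by apply: cvg_realC; exact: powR_continuous.
exists (`|c| + 1); first by rewrite ltr_wpDl.
move=> t; rewrite !lt_min => /andP[t0 /andP[/andP[_ te1] /andP[t1 tr]]].
rewrite normrM norm_realC (ger0_norm (powR_ge0 _ _)) opprD powRD; last first.
  by apply/implyP => _; rewrite gt_eqF.
rewrite rmorphM/= ler_pM//.
- by rewrite lecR powR_ge0.
- rewrite lecR; apply: ger_powR; first by rewrite t0 ltW.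
  by rewrite lerNl -normrN ler_norm.
- rewrite (le_trans (e1P _ _)) ?t0// lecR (powR_inv1 (ltW t0)).
  by rewrite -[leLHS]invrK lef_pV2 ?posrE ?invr_gt0// ltW.
Qed.

Lemma simeq_asym_scaled b c r : 0 < b -> {within `[0, b], continuous r} ->
  simeq_asym (fun t => (t `^ c)%:C * r t) (r 0) (rmin_fin c).
Proof.
move=> b0 /(continuous_within_itvP _ b0)[_ cr _]; rewrite /simeq_asym/=.
apply: cvg_trans (near_eq_cvg _) cr.
near=> t; rewrite mulrA -rmorphM/= -powRD; last first.
  by apply/implyP => _; rewrite gt_eqF//; near: t; exact: nbhs_right_gt.
by rewrite addNr powRr0 mul1r.
Unshelve. all: by end_near.
Qed.

(** On the disc, [G t] differs from the non-zero constant [g] by at most |g|/2, so it cannot vanish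
    there. *)
Lemma no_bounded_root b (G : R -> {poly R[i]}) (N : nat) (rho : R[i]) :
  0 < b -> coef_continuous b G -> (forall t, (size (G t) <= N)%N) ->
  size (G 0) = 1%N -> 0 <= rho ->
  exists2 e : R, 0 < e & forall t, 0 <= t <= b -> t < e ->
    forall z, `|z| <= rho -> ~~ root (G t) z.
Proof.
move=> b0 cG sG /eqP/size_poly1P[g g0 GE] rho0.
have g20 : 0 < `|g| / 2 by rewrite divr_gt0// normr_gt0.
have [dl dl0 dlP] := horner_nderivn_small N 0 rho0 g20.
have [e e0 eP] := coef_continuous_unif cG sG dl0.
exists e => // t tb te z zrho; apply/negP => /rootP Gz.
have : `|(G t - G 0)^`N(0).[z]| <= `|g| / 2.
  apply: dlP => //.
    by rewrite (leq_trans (size_polyD _ _))// size_polyN geq_max !sG.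
  apply: eP => //; first by rewrite lexx ltW.
  by rewrite subr0 ger0_norm//; case/andP: tb.
rewrite nderivn0 hornerD hornerN Gz GE hornerC sub0r normrN.
by rewrite ler_pdivlMr// ger_pMr ?normr_gt0// lern1.
Qed.

End Asymptotics.

(** * Change of unknown and roots of the rescaled polynomial *)

Section Rescaling.
Variable R : realType.

Lemma coef_comp_scaleX (p : {poly R[i]}) k j :
  (p \Po (k *: 'X))`_j = p`_j * k ^+ j.
Proof.
rewrite comp_polyE coef_sum.
under eq_bigr do rewrite exprZn !coefZ coefXn.
have [pj|jp] := leqP (size p) j.
  rewrite nth_default// mul0r big1// => i _.
  by rewrite gtn_eqF ?mulr0// (leq_trans (ltn_ord i)).
rewrite (bigD1 (Ordinal jp))//= eqxx mulr1 big1 ?addr0// => i ij.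
by rewrite -val_eqE eq_sym in ij; rewrite (negbTE ij) !mulr0.
Qed.

(** Replacing X by X/u multiplies each root by u and releases a scalar 1/u per linear factor, which
    the cofactor absorbs. *)
Lemma comp_scaleX_prod (s : seq R[i]) (G : {poly R[i]}) u : u != 0 ->
  (\prod_(z <- s) ('X - z%:P) * G) \Po (u^-1 *: 'X) =
  \prod_(z <- [seq u * z | z <- s]) ('X - z%:P) *
    (u^-1 ^+ size s *: (G \Po (u^-1 *: 'X))).
Proof.
move=> u0; rewrite rmorphM/= -scalerAr scalerAl; congr (_ * _).
elim: s => [|z s IH]; first by rewrite !big_nil rmorph1 scale1r.
rewrite !big_cons rmorphM/= IH exprSr -scalerA -!scalerAr; congr (_ *: _).
rewrite scalerAl; congr (_ * _).
rewrite rmorphB/= comp_polyX comp_polyC scalerBr; congr (_ - _).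
by rewrite -mul_polyC -polyCM mulKf.
Qed.

End Rescaling.

Lemma poly_at_rescale (R : realType) (n : nat) (PP : nat -> R -> R[i])
    (c h e : R) : 0 < e ->
  poly_at n PP e = (e `^ h)%:C *:
    ((\poly_(j < n.+1) ((e `^ (c *+ j - h))%:C * PP j e)) \Po
       ((e `^ c)%:C^-1 *: 'X)).
Proof.
move=> e0; apply/polyP => j; rewrite coefZ coef_comp_scaleX !coef_poly.
case: ifP => _; last by rewrite mul0r mulr0.
have uC x : (e `^ x)%:C != 0 :> R[i].
  by rewrite (inj_eq (@complexI R) _ 0) gt_eqF// powR_gt0.
have eX : e `^ (c *+ j) = (e `^ c) ^+ j.
  by rewrite -mulr_natr powRrM powR_mulrn// powR_ge0.
rewrite powRB; last by apply/implyP => _; rewrite gt_eqF.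
rewrite eX rmorphM/= fmorphV/= rmorphXn/= exprVn.
rewrite -!mulrA [X in _ * X]mulrCA mulVKf ?uC// mulrC -mulrA mulVf ?mulr1//.
by rewrite expf_neq0.
Qed.

(** The analytic core, with the min-plus data reduced to the exponents [c] and [h]. The order of [s]
    is left free, and the continuous roots are reindexed to follow it. *)
Lemma roots_asymptotics (R : realType) (n : nat) (PP : nat -> R -> R[i])
    (q : {poly R[i]}) (c h : R) (s : seq R[i]) :
  (forall j, (j <= n)%N -> in_germs (PP j)) ->
  q != 0 -> (size q <= n.+1)%N ->
  (forall j, (j <= n)%N ->
    (t `^ (c *+ j - h))%:C * PP j t @[t --> 0^'+] --> q`_j) ->
  perm_eq s (croots q) ->
  exists (Y : nat -> R -> R[i]) (rest : R -> seq (option R[i])),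
  [/\ forall i, (i < size s)%N -> in_germs (Y i),
      forall i, (i < size s)%N -> simeq_asym (Y i) s`_i (rmin_fin c),
      \forall e \near 0^'+,
        perm_eq (proj_roots n (poly_at n PP e))
          ([seq Some (Y i e) | i <- iota 0 (size s)] ++ rest e) /\
        (size (rest e) + size s = n)%N
    & forall rho : R, 0 < rho -> \forall e \near 0^'+,
        forall z, z \in rest e -> modulus_gt z (rho * e `^ c)].
Proof.
move=> hPP q0 sq cPP sP.
have [e0 e00 ce] := common_germ_domain hPP.
pose F j t := (t `^ (c *+ j - h))%:C * PP j t.
pose A t := \poly_(j < n.+1) (if 0 < t then F j t else q`_j).
(* Halving keeps the right end of the closed interval inside the domain of continuity. *)
have e20 : 0 < e0 / 2 by rewrite divr_gt0.
have cA : coef_continuous (e0 / 2) A.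
  move=> j; have [jn|nj] := ltnP j n.+1; last first.
    rewrite (_ : (fun t => _) = cst 0); first exact: cst_continuous.
    by apply/funext => t; rewrite coef_poly ltnNge nj.
  rewrite (_ : (fun t => _) = (fun t => if 0 < t then F j t else q`_j)).
    apply: within_continuous_extend0; [exact: e20| |exact: cPP].
    move=> t /andP[t0 te]; apply: cvgM.
      by apply: cvg_realC; exact: powR_continuous.
    apply: (ce j jn); rewrite t0 (le_lt_trans te)//.
    by rewrite ltr_pdivrMr// ltr_pMr// ltr1n.
  by apply/funext => t; rewrite coef_poly jn.
have sA t : (size (A t) <= n.+1)%N by exact: size_poly.
have A0 : A 0 = q.
  apply/polyP => j; rewrite coef_poly ltxx; case: ltnP => // nj.
  by rewrite nth_default// (leq_trans sq).
pose d := (size q).-1.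
have [|b [r [G [/andP[b0 be] cr [cG sG] G0 GE]]]] :=
  continuous_factorization (d := d) e20 cA sA.
  by rewrite A0 prednK// size_poly_gt0.
have prodE t : \prod_(i < d) ('X - (r i t)%:P) =
    \prod_(z <- [seq r i t | i <- iota 0 d]) ('X - z%:P).
  by rewrite big_map -(big_mkord xpredT (fun i => 'X - (r i t)%:P))
    /index_iota subn0.
have : perm_eq s [seq r i 0 | i <- iota 0 d].
  apply: (perm_trans sP); rewrite -A0 GE ?lexx ?(ltW b0)// prodE.
  have GO0 : G 0 != 0 by rewrite -size_poly_gt0 G0.
  have := croots_prod [seq r i 0 | i <- iota 0 d] GO0.
  by rewrite [croots (G 0)]size0nil ?cats0// size_croots// G0.
(* [Is] matches the values at 0 of the continuous roots with the entries of [s]. *)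
move=> /(perm_iotaP 0)[Is]; rewrite size_map size_iota => pIs sE.
have sIs : size Is = d by rewrite (perm_size pIs) size_iota.
have ss : size s = d by rewrite sE size_map.
pose Y i t := (t `^ c)%:C * r (nth 0%N Is i) t.
pose u (t : R) := (t `^ c)%:C : R[i].
(* The cofactor in the original unknown, with the released scalars. *)
pose Gs t := (t `^ h)%:C *: ((u t)^-1 ^+ d *: (G t \Po ((u t)^-1 *: 'X))).
(* All the roots at infinity, due to a drop of degree, go to the rest. *)
pose rest t := map Some (croots (Gs t)) ++
  nseq (n - (size (poly_at n PP t)).-1) None.
have u0 t : 0 < t -> u t != 0.
  by move=> t0; rewrite (inj_eq (@complexI R) _ 0) gt_eqF// powR_gt0.
have polyE t : 0 < t <= b -> poly_at n PP t =
    \prod_(z <- [seq u t * r i t | i <- iota 0 d]) ('X - z%:P) * Gs t.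
  move=> /andP[t0 tb]; rewrite (poly_at_rescale _ _ c h t0).
  have -> : \poly_(j < n.+1) ((t `^ (c *+ j - h))%:C * PP j t) = A t.
    by apply/polyP => j; rewrite !coef_poly t0.
  rewrite GE ?(ltW t0)// prodE comp_scaleX_prod ?u0//.
  by rewrite size_map size_iota scalerAr -map_comp.
have GsX t z : 0 < t -> root (Gs t) z = root (G t) ((u t)^-1 * z).
  move=> t0; have w0 : (t `^ h)%:C != 0 :> R[i].
    by rewrite (inj_eq (@complexI R) _ 0) gt_eqF// powR_gt0.
  rewrite /Gs !rootZ// ?expf_neq0 ?invr_eq0 ?u0//.
  by rewrite /root horner_comp hornerZ hornerX.
have Gs_neq0 t : 0 < t -> G t != 0 -> Gs t != 0.
  move=> t0; apply: contra => /eqP Gs0.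
  apply/eqP/polyP => j; have := congr1 (fun p : {poly R[i]} => p`_j) Gs0.
  rewrite !coefZ coef_comp_scaleX !coef0 => /eqP.
  rewrite !mulf_eq0 !expf_eq0 !invr_eq0 (negbTE (u0 t t0)) !andbF orbF/=.
  by rewrite (inj_eq (@complexI R) _ 0) gt_eqF ?powR_gt0//= => /eqP.
(* Radius 0 suffices here: if 0 is not a root of [G t], then [G t] is non-zero. *)
have [eG eG0 eGP] := no_bounded_root b0 cG sG G0 (lexx 0).
have G_neq0 t : 0 < t <= b -> t < eG -> G t != 0.
  move=> /andP[t0 tb] te; have := eGP t _ te 0.
  rewrite (ltW t0) tb normr0 => /(_ isT (lexx _)); apply: contraNneq => ->.
  exact: root0.
exists Y, rest; split.
- by move=> i _; exact: in_germs_scaled b0 (cr _).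
- move=> i; rewrite ss => id; have iIs : (nth 0%N Is i < d)%N.
    by have := mem_nth 0%N (s := Is) (n := i); rewrite sIs (perm_mem pIs)
      mem_iota => /(_ id).
  have -> : s`_i = r (nth 0%N Is i) 0.
    rewrite sE (nth_map 0%N) ?sIs// (nth_map 0%N) ?size_iota//.
    by rewrite nth_iota.
  exact: simeq_asym_scaled b0 (cr _).
- near=> e; have e_gt0 : 0 < e by near: e; exact: nbhs_right_gt.
  have eb : 0 < e <= b.
    by rewrite e_gt0 ltW//; near: e; exact: nbhs_right_lt.
  have eeG : e < eG by near: e; exact: nbhs_right_lt.
  have Gs0 := Gs_neq0 e e_gt0 (G_neq0 e eb eeG).
  have pc := croots_prod [seq u e * r i e | i <- iota 0 d] Gs0.
  rewrite -(polyE e eb) in pc.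
  have P0 : poly_at n PP e != 0.
    by rewrite (polyE e eb) mulf_neq0// monic_neq0// monic_prod_XsubC.
  have sP' : (size (poly_at n PP e)).-1 = (d + size (croots (Gs e)))%N.
    by rewrite -size_croots// (perm_size pc) size_cat size_map size_iota.
  split; last first.
    rewrite /rest size_cat size_map size_nseq sP' ss addnAC.
    rewrite [X in (X + _)%N]addnC.
    by rewrite subnKC// -sP' -subn1 leq_subLR add1n size_poly.
  rewrite /proj_roots /rest catA perm_cat2r.
  rewrite (perm_trans (perm_map Some pc))// map_cat perm_cat2r -map_comp.
  have -> : [seq Some (Y i e) | i <- iota 0 (size s)] =
      [seq Some (u e * r i e) | i <- Is].
    by rewrite -[in RHS](mkseq_nth 0%N Is) /mkseq -map_comp sIs ss.
  by rewrite perm_sym; exact: perm_map.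
- move=> rho rho0; have rhoC : 0 <= rho%:C :> R[i] by rewrite ler0c ltW.
  have [e1 e10 e1P] := no_bounded_root b0 cG sG G0 rhoC.
  near=> e => -[z|//]; have e_gt0 : 0 < e by near: e; exact: nbhs_right_gt.
  have eb : 0 < e <= b.
    by rewrite e_gt0 ltW//; near: e; exact: nbhs_right_lt.
  have eeG : e < eG by near: e; exact: nbhs_right_lt.
  have ee1 : e < e1 by near: e; exact: nbhs_right_lt.
  rewrite mem_cat => /orP[|/nseqP[]//].
  (* A root of [Gs e] is e^c times a root of [G e], which has none of modulus at most [rho]. *)
  rewrite (mem_map (@Some_inj _)) mem_croots ?Gs_neq0 ?G_neq0// GsX//= => Gz.
  rewrite real_ltNge ?normr_real//; last by apply/complex_realP; eexists.
  apply: contraL Gz => zle; apply: e1P => //.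
    by case/andP: eb => /ltW-> ->.
  rewrite normrM normfV norm_realC (ger0_norm (powR_ge0 _ _)) mulrC.
  by rewrite ler_pdivrMr -?rmorphM// ltcR powR_gt0.
Unshelve. all: by end_near.
Qed.

(** * From the min-plus data to the theorem *)

Lemma poly_val_neq0 (R : realType) (q : {poly R[i]}) :
  q != 0 -> q`_(poly_val q) != 0.
Proof.
move=> q0; apply: (@nth_find _ 0 (fun a => a != 0)); apply/hasP.
exists (lead_coef q); last by rewrite lead_coef_eq0.
by rewrite mem_nth// prednK// size_poly_gt0.
Qed.

Local Close Scope complex_scope.

Theorem theorem6p1 (R : realType) (n : nat) (PP : nat -> R -> R[i])
    (p : {poly R[i]}) (P : {poly Rmin R}) (cs : seq (Rmin R)) (c : R)
    (y : seq R[i])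
    (hPP : forall j : nat, (j <= n)%N -> in_germs (PP j))
    (hp : (size p <= n.+1)%N) (hP : (size P <= n.+1)%N)
    (hasym : forall j : nat, (j <= n)%N -> simeq_asym (PP j) p`_j P`_j)
    (hcs : minplus_roots P cs) (hc : rmin_fin c \in cs)
    (hpc : saturated_poly n p P (rmin_fin c) != 0)
    (hy : perm_eq y
      [seq z <- croots (saturated_poly n p P (rmin_fin c)) | z != 0]) :
  let m := count_mem (rmin_fin c) cs in
  let m' := count (fun d => (c%:E < rmin_val d)%E) cs in
  let l := size y in
  let v := poly_val (saturated_poly n p P (rmin_fin c)) in
  [/\ (l <= m)%N,
      ((0 < v)%N -> (m' <= v)%N),
      (exists (Y : nat -> R -> R[i]) (rest : R -> seq (option R[i])),
        [/\ forall i : nat, (i < v + l)%N -> in_germs (Y i),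
            forall i : nat, (i < l)%N -> sim_asym (Y i) y`_i (rmin_fin c),
            forall i : nat, (l <= i < v + l)%N ->
              simeq_asym (Y i) 0 (rmin_fin c),
            \forall e \near 0^'+,
              perm_eq (proj_roots n (poly_at n PP e))
                ([seq Some (Y i e) | i <- iota 0 (v + l)] ++ rest e) /\
              (size (rest e) + v + l = n)%N
          & forall r : R, 0 < r -> \forall e \near 0^'+,
              forall z : option R[i], z \in rest e ->
                modulus_gt z (r * e `^ c)])
    & n%:Z - m%:Z - m'%:Z <= n%:Z - v%:Z - l%:Z].
Proof.
move=> m m' l v; set q := saturated_poly n p P (rmin_fin c) in hpc hy v *.
have qj j : q`_j = if (j <= n)%N && (P.[rmin_fin c] == P`_j * rmin_fin c ^+ j)
    then p`_j else 0.
  by rewrite coef_poly ltnS; case: (j <= n)%N.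
(* Used at the lowest exponent [v] and at the degree [v + l] of [q], this gives m' <= v and v + l <=
   m' + m, whence l <= m. *)
have qbounds j : q`_j != 0 -> (m' <= j <= m' + m)%N.
  rewrite qj; case: ifP => [/andP[_ /eqP]|]; last by rewrite eqxx.
  by move=> /(minimal_term_bounds hcs).
have sq : (size q <= n.+1)%N by exact: size_poly.
have vE : v = count_mem 0 (croots q) by exact: poly_val_croots.
have lE : l = count (fun z => z != 0) (croots q).
  by rewrite /l (perm_size hy) size_filter.
have vl : (v + l)%N = (size q).-1.
  by rewrite vE lE -size_croots// -(count_predC (pred1 0) (croots q)).
have /andP[m'v _] := qbounds _ (poly_val_neq0 hpc).
have /andP[_] : (m' <= (size q).-1 <= m' + m)%N.
  by apply: qbounds; rewrite -/(lead_coef q) lead_coef_eq0.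
rewrite -vl -/v in m'v * => vlm.
have lm : (l <= m)%N.
  by rewrite -(leq_add2l m') (leq_trans _ vlm)// leq_add2r.
split => //.
(* The non-zero roots come first, as the numbering of the [Y i] demands. *)
- pose s := y ++ nseq v 0.
  have ss : size s = (v + l)%N by rewrite size_cat size_nseq addnC.
  have sP : perm_eq s (croots q).
    pose nz : pred R[i] := fun z => z != 0.
    apply: (perm_trans (y := [seq z <- croots q | nz z] ++
      [seq z <- croots q | predC nz z])); last by rewrite perm_filterC.
    rewrite perm_cat// perm_sym.
    rewrite (_ : [seq x <- _ | _] = nseq v 0)//.
    rewrite (@eq_filter _ _ (pred1 0)); last by move=> z; rewrite /= negbK.
    have /all_pred1P -> : all (pred1 0) [seq x <- croots q | pred1 0 x].
      exact: filter_all.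
    by rewrite size_filter -vE.
  (* [h] is the value at [c] of the polynomial function of [P]. *)
  have [L /(_ c) Pc] := minplus_rootsE hcs; move: Pc; set h := L + _ => Pc.
  have [|Y [rest [Ygerm Yasym Yperm Yrest]]] :=
    roots_asymptotics (c := c) (h := h) hPP hpc sq _ sP.
    (* The exponent P_j + jc - h is non-negative because [h] is a minimum, and it vanishes exactly
       for the terms kept in p^(c). *)
    move=> j jn; have := rescaled_cvg (s := c *+ j - h) (hasym j jn).
    have := horner_rmin_le P (rmin_fin c) j.
    rewrite qj jn Pc rmin_finX -!val_eqE/=.
    case: (P`_j) => [[x| |] Hx]; rewrite ?eqe //= => xh; last by apply.
    rewrite opprB [x == _]eq_sym subr_eq; apply=> y0 [<-].
    by move: xh; rewrite -EFinD lee_fin; lra.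
  rewrite ss in Ygerm Yasym Yperm.
  exists Y, rest; split => //.
  + move=> i il; split.
      have := Yasym i; rewrite nth_cat il; apply.
      by rewrite (leq_trans il)// leq_addl.
    left; split => //; have : y`_i \in y by exact: mem_nth.
    by rewrite (perm_mem hy) mem_filter => /andP[].
  + move=> i /andP[li ivl]; have := Yasym i ivl.
    by rewrite nth_cat ltnNge li/= nth_nseq if_same.
  + by apply: filterS Yperm => e [? sn]; rewrite -addnA.
- move: vlm; clear; lia.
Qed.
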